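(* Let $\mathcal{R}M=D\mathcal{C}$ be a proper U-match decomposition of $D\in\mathbb{K}^{m\times n}$. Given access to $D$, $M$ and $(\mathcal{R}_{\rho\rho})^{-1}$, one can reconstruct any row or column of $\mathcal{R}$, $\mathcal{R}^{-1}$, $\mathcal{C}$ or $\mathcal{C}^{-1}$ in $O(mn)$ time.
   Context: $\mathbb{K}$ is a field. Time is measured by the number of field operations and elementary index operations, and rows and columns of $D$, $M$ and $(\mathcal{R}_{\rho\rho})^{-1}$ can be accessed directly. A (generalized) matching matrix is a matrix with at most one nonzero entry in each row and each column. A U-match decomposition of $D\in\mathbb{K}^{m\times n}$ is a tuple $(\mathcal{R},M,D,\mathcal{C})$ with $\mathcal{R}M=D\mathcal{C}$, where $M\in\mathbb{K}^{m\times n}$ is a matching matrix and $\mathcal{R}\in\mathbb{K}^{m\times m}$, $\mathcal{C}\in\mathbb{K}^{n\times n}$ are upper unitriangular (upper triangular with ones on the diagonal). $\rho$ is the increasing sequence of row indices $r$ with $\mathrm{row}_r(M)\ne 0$, and $\mathcal{R}_{\rho\rho}$ is the submatrix of $\mathcal{R}$ with rows and columns indexed by $\rho$. The decomposition is proper if (A1) whenever $\mathrm{col}_k(M)=0$, $\mathrm{row}_k(\mathcal{C})$ is the $k$th standard unit row vector; and (A2) whenever $\mathrm{row}_k(M)=0$, $\mathrm{col}_k(\mathcal{R})$ is the $k$th standard unit column vector. *)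

(* Defs.v *)
From HB Require Import structures.
From mathcomp Require Import all_boot all_algebra.

Set Implicit Arguments.
Unset Strict Implicit.
Unset Printing Implicit Defensive.

Import GRing.Theory.
Local Open Scope ring_scope.

(** * U-match decompositions *)

Section UMatch.

Variable K : fieldType.

Definition matching_mx m n (M : 'M[K]_(m, n)) : Prop :=
  (forall i j j', M i j != 0 -> M i j' != 0 -> j = j') /\
  (forall i i' j, M i j != 0 -> M i' j != 0 -> i = i').

Definition upper_unitri n (A : 'M[K]_n) : Prop :=
  (forall i j : 'I_n, (j < i)%N -> A i j = 0) /\ (forall i, A i i = 1).

Definition umatch m n (R : 'M[K]_m) (M D : 'M[K]_(m, n)) (C : 'M[K]_n) : Prop :=
  [/\ matching_mx M, upper_unitri R, upper_unitri C & R *m M = D *m C].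

Definition proper_umatch m n (R : 'M[K]_m) (M D : 'M[K]_(m, n))
    (C : 'M[K]_n) : Prop :=
  [/\ umatch R M D C,
      forall k : 'I_n, col k M = 0 -> row k C = delta_mx 0 k &
      forall k : 'I_m, row k M = 0 -> col k R = delta_mx k 0].

Definition nzrows m n (M : 'M[K]_(m, n)) : {set 'I_m} :=
  [set r | row r M != 0].

(** [enum_val] lists the elements of a set of ordinals in increasing order. *)
Definition rho m n (M : 'M[K]_(m, n)) : 'I_#|nzrows M| -> 'I_m :=
  @enum_val _ (mem (nzrows M)).

Definition rhorho m n (M : 'M[K]_(m, n)) (R : 'M[K]_m) : 'M[K]_#|nzrows M| :=
  mxsub (rho (M := M)) (rho (M := M)) R.

End UMatch.

(** * Machine model

    A program is a piece of syntax that mentions neither the field nor the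
    dimensions; every node of an expression or command costs one time unit
    each time it is evaluated.  There are two sorts of data, indices (natural
    numbers) and field elements, each with scalar registers and
    one-dimensional arrays.  The only arithmetic on indices is 0, successor
    and predecessor, so an index never exceeds the inputs by more than the
    elapsed time. *)

(** Read-only inputs: [D], [M] and the inverse of [R_rhorho]. *)
Inductive input_name := InD | InM | InRinv.

Inductive iexp :=
| IVar of nat
| IZero
| ISucc of iexp
| IPred of iexp
| IGet of nat & iexp.

Inductive fexp :=
| FVar of nat
| FZero
| FOne
| FAdd of fexp & fexp
| FOpp of fexp
| FMul of fexp & fexp
| FInv of fexp
| FGet of nat & iexp
| FInput of input_name & iexp & iexp.

Inductive bexp :=
| BLt of iexp & iexp
| BEqI of iexp & iexp
| BEqF of fexp & fexp
| BNot of bexp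
| BAnd of bexp & bexp.

Inductive cmd :=
| CSkip
| CISet of nat & iexp
| CFSet of nat & fexp
| CIPut of nat & iexp & iexp
| CFPut of nat & iexp & fexp
| CSeq of cmd & cmd
| CIf of bexp & cmd & cmd
| CWhile of bexp & cmd.

Fixpoint icost (e : iexp) : nat :=
  match e with
  | IVar _ | IZero => 1
  | ISucc e1 | IPred e1 | IGet _ e1 => (icost e1).+1
  end.

Fixpoint fcost (e : fexp) : nat :=
  match e with
  | FVar _ | FZero | FOne => 1
  | FAdd e1 e2 | FMul e1 e2 => (fcost e1 + fcost e2).+1
  | FOpp e1 | FInv e1 => (fcost e1).+1
  | FGet _ i => (icost i).+1
  | FInput _ i j => (icost i + icost j).+1
  end.

Fixpoint bcost (b : bexp) : nat :=
  match b with
  | BLt e1 e2 | BEqI e1 e2 => (icost e1 + icost e2).+1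
  | BEqF e1 e2 => (fcost e1 + fcost e2).+1
  | BNot b1 => (bcost b1).+1
  | BAnd b1 b2 => (bcost b1 + bcost b2).+1
  end.

Definition upd (T : Type) (f : nat -> T) (x : nat) (v : T) : nat -> T :=
  fun y => if y == x then v else f y.

Section Semantics.

Variable K : fieldType.

Record store := Store {
  ivar : nat -> nat;
  fvar : nat -> K;
  iarr : nat -> nat -> nat;
  farr : nat -> nat -> K
}.

Definition set_ivar s x v := Store (upd (ivar s) x v) (fvar s) (iarr s) (farr s).
Definition set_fvar s x v := Store (ivar s) (upd (fvar s) x v) (iarr s) (farr s).
Definition put_iarr s a i v :=
  Store (ivar s) (fvar s) (upd (iarr s) a (upd (iarr s a) i v)) (farr s).
Definition put_farr s a i v :=
  Store (ivar s) (fvar s) (iarr s) (upd (farr s) a (upd (farr s a) i v)).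

(** Out-of-range accesses to an input matrix return 0. *)
Definition entry m n (A : 'M[K]_(m, n)) (i j : nat) : K :=
  match insub i : option 'I_m, insub j : option 'I_n with
  | Some i', Some j' => A i' j'
  | _, _ => 0
  end.

Variable inp : input_name -> nat -> nat -> K.

Fixpoint ieval (s : store) (e : iexp) : nat :=
  match e with
  | IVar x => ivar s x
  | IZero => 0
  | ISucc e1 => (ieval s e1).+1
  | IPred e1 => (ieval s e1).-1
  | IGet a e1 => iarr s a (ieval s e1)
  end.

Fixpoint feval (s : store) (e : fexp) : K :=
  match e with
  | FVar x => fvar s x
  | FZero => 0
  | FOne => 1
  | FAdd e1 e2 => feval s e1 + feval s e2
  | FOpp e1 => - feval s e1
  | FMul e1 e2 => feval s e1 * feval s e2
  | FInv e1 => (feval s e1)^-1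
  | FGet a i => farr s a (ieval s i)
  | FInput x i j => inp x (ieval s i) (ieval s j)
  end.

Fixpoint beval (s : store) (b : bexp) : bool :=
  match b with
  | BLt e1 e2 => (ieval s e1 < ieval s e2)%N
  | BEqI e1 e2 => ieval s e1 == ieval s e2
  | BEqF e1 e2 => feval s e1 == feval s e2
  | BNot b1 => ~~ beval s b1
  | BAnd b1 b2 => beval s b1 && beval s b2
  end.

(** [exec c s t s']: started in [s], the command [c] halts in [s'] after
    exactly [t] time units. *)
Inductive exec : cmd -> store -> nat -> store -> Prop :=
| ExSkip s : exec CSkip s 1 s
| ExISet s x e : exec (CISet x e) s (icost e).+1 (set_ivar s x (ieval s e))
| ExFSet s x e : exec (CFSet x e) s (fcost e).+1 (set_fvar s x (feval s e))
| ExIPut s a i e :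
    exec (CIPut a i e) s (icost i + icost e).+1
      (put_iarr s a (ieval s i) (ieval s e))
| ExFPut s a i e :
    exec (CFPut a i e) s (icost i + fcost e).+1
      (put_farr s a (ieval s i) (feval s e))
| ExSeq c1 c2 s s1 s2 t1 t2 :
    exec c1 s t1 s1 -> exec c2 s1 t2 s2 ->
    exec (CSeq c1 c2) s (t1 + t2).+1 s2
| ExIfTrue b c1 c2 s s1 t1 :
    beval s b -> exec c1 s t1 s1 ->
    exec (CIf b c1 c2) s (bcost b + t1).+1 s1
| ExIfFalse b c1 c2 s s1 t1 :
    ~~ beval s b -> exec c2 s t1 s1 ->
    exec (CIf b c1 c2) s (bcost b + t1).+1 s1
| ExWhileFalse b c s :
    ~~ beval s b -> exec (CWhile b c) s (bcost b).+1 s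
| ExWhileTrue b c s s1 s2 t1 t2 :
    beval s b -> exec c s t1 s1 -> exec (CWhile b c) s1 t2 s2 ->
    exec (CWhile b c) s (bcost b + t1 + t2).+1 s2.

(** Index registers 0, 1, 2 hold [m], [n] and the (0-based) index of the
    requested row or column; all other memory is zero. *)
Definition init_store (m n k : nat) : store :=
  Store (fun x => nth 0%N [:: m; n; k] x) (fun=> 0) (fun _ _ => 0%N)
    (fun _ _ => 0).

End Semantics.

Definition umatch_inputs (K : fieldType) m n (D M : 'M[K]_(m, n))
    (R : 'M[K]_m) (x : input_name) : nat -> nat -> K :=
  match x with
  | InD => entry D
  | InM => entry M
  | InRinv => entry (invmx (rhorho M R))
  end.

(** * What is to be reconstructed *)

Inductive target := TR | TRinv | TC | TCinv.

Definition target_dim (t : target) (m n : nat) : nat :=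
  match t with TR | TRinv => m | TC | TCinv => n end.

Definition target_mx (K : fieldType) (t : target) m n (R : 'M[K]_m)
    (C : 'M[K]_n) : 'M[K]_(target_dim t m n) :=
  match t with
  | TR => R
  | TRinv => invmx R
  | TC => C
  | TCinv => invmx C
  end.

Inductive line := Row | Col.

Definition line_entry (K : fieldType) (l : line) d (A : 'M[K]_d)
    (k j : 'I_d) : K :=
  match l with Row => A k j | Col => A j k end.

(* Main.v *)
Require Import Defs.
From mathcomp Require Import all_boot all_algebra zify.

(** Let [M^+] be the transposed matrix of inverses of the entries of [M], let
    [S] be [(R_rhorho)^-1] extended by zeros to an [m * m] matrix, and let [I']
    and [I''] be the diagonal projections onto the zero rows and the zero
    columns of [M].  Properness says [R I' = I'] and [I'' C = I''], from which
<<
      C^-1 = I'' + M^+ S D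
      R    = I' + D C M^+
      R^-1 = I' (1 - D C M^+ S) + S.
>>
    Forming the product [M^+ S D] would be too expensive, but a triangular
    system with matrix [C^-1] is solved by substitution in time [O(mn)]: it
    suffices to maintain the [m]-vector [z = D x] (or [z = x M^+ S]) of the
    unknowns found so far, since each new unknown then costs one scalar product
    with [z] and one update of [z].  This gives [C b] or [b C] for any vector
    [b], and every requested line is one such product followed by one
    matrix-vector product. *)

Set Implicit Arguments.
Unset Strict Implicit.
Unset Printing Implicit Defensive.

Import GRing.Theory.

(** * Matrix identities *)

Section UpperUnitriangular.
Local Open Scope ring_scope.
Variables (K : fieldType) (n : nat).
Implicit Types A : 'M[K]_n.

Lemma upper_unitri_unitmx A : upper_unitri A -> A \in unitmx.
Proof.
move=> [A0 A1]; rewrite -unitmx_tr unitmxE det_trig.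
  by rewrite big1 ?unitr1 // => i _; rewrite mxE A1.
by apply/is_trig_mxP => i j ltij; rewrite mxE A0.
Qed.

(** The [(i, j)] entry of [A A^-1 = 1] expresses an entry of [A^-1] through entries further down its
    column, so the induction runs upwards from the last row, with [d] bounding [n - i]. *)
Lemma upper_unitri_invmx A : upper_unitri A -> upper_unitri (invmx A).
Proof.
move=> uA; have AV := mulmxV (upper_unitri_unitmx uA).
case: uA => A0 A1; set B := invmx A in AV *.
have row_eq i j : B i j + \sum_(k | k != i) A i k * B k j = (i == j)%:R.
  by move/matrixP/(_ i j): AV; rewrite !mxE (bigD1 i) //= A1 mul1r.
suff low d (i j : 'I_n) : (n - i <= d)%N -> (j < i)%N -> B i j = 0.
  split=> [i j|i]; first exact: (low (n - i)%N).
  have := row_eq i i; rewrite eqxx big1 ?addr0 // => k neki.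
  have [ltki|lik] := ltnP k i; first by rewrite A0 ?mul0r.
  by rewrite (low (n - k)%N) ?mulr0 // ltn_neqAle lik eq_sym neki.
elim: d i j => [|d IHd] i j; first by rewrite leqn0 subn_eq0 leqNgt ltn_ord.
move=> le_id ltji; have := row_eq i j.
rewrite -val_eqE gtn_eqF // big1 ?addr0 // => k neki.
have [ltki|lik] := ltnP k i; first by rewrite A0 ?mul0r.
have ltik : (i < k)%N by rewrite ltn_neqAle lik eq_sym neki.
rewrite IHd ?mulr0 ?(ltn_trans ltji) //.
by rewrite -ltnS (leq_trans _ le_id) // ltn_sub2l.
Qed.

End UpperUnitriangular.

(** * Formulas for [R], [R^-1] and [C^-1] through [M^+] and [S] *)

Section Reconstruction.
Local Open Scope ring_scope.
Variables (K : fieldType) (m n : nat).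
Variables (D M : 'M[K]_(m, n)) (R : 'M[K]_m) (C : 'M[K]_n).
Hypothesis properRMDC : proper_umatch R M D C.

(* Since [0^-1 = 0], this is the pseudo-inverse of the matching matrix [M]:
   [M *m matching_pinv] and [matching_pinv *m M] are the diagonal projections
   onto the nonzero rows and columns of [M]. *)
Definition matching_pinv : 'M[K]_(n, m) := \matrix_(c, r) (M r c)^-1.

(** These two are the projections [I'] and [I'']. *)
Definition null_rows : 'M[K]_m := 1%:M - M *m matching_pinv.
Definition null_cols : 'M[K]_n := 1%:M - matching_pinv *m M.

(** Turns passage to the [rho]-[rho] block into [rho_incl^T *m A *m rho_incl], and extension by
    zeros into the reverse product. *)
Definition rho_incl : 'M[K]_(m, #|nzrows M|) := \matrix_(r, i) (r == rho i)%:R.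

(** The matrix [S]. *)
Definition rho_inv : 'M[K]_m :=
  rho_incl *m invmx (rhorho M R) *m rho_incl^T.

Let matchM : matching_mx M. Proof. by case: properRMDC => [[]]. Qed.
Let unitriR : upper_unitri R. Proof. by case: properRMDC => [[]]. Qed.
Let unitriC : upper_unitri C. Proof. by case: properRMDC => [[]]. Qed.
Let RM_DC : R *m M = D *m C. Proof. by case: properRMDC => [[]]. Qed.

Lemma mem_nzrows r : (r \in nzrows M) = [exists c, M r c != 0].
Proof.
rewrite inE; apply/idP/existsP => [|[c]]; last first.
  by apply: contraNneq => /rowP/(_ c); rewrite !mxE => ->.
case: (pickP (fun c => M r c != 0)) => [c|M0]; first by exists c.
by case/eqP; apply/rowP => c; have /negbFE/eqP := M0 c; rewrite !mxE.
Qed.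

(** Nonzero entries in one column lie in one row, so off-diagonal sums vanish; a nonzero row has a
    single nonzero entry [x], which contributes [x * x^-1 = 1]. *)
Lemma row_projE r r' :
  (M *m matching_pinv) r r' = ((r == r') && (r \in nzrows M))%:R.
Proof.
rewrite mxE mem_nzrows; have [<-{r'}|ner] /= := eqVneq; last first.
  apply: big1 => c _; rewrite mxE; have [->|Mr] := eqVneq (M r c) 0.
    by rewrite mul0r.
  have [->|Mr'] := eqVneq (M r' c) 0; first by rewrite invr0 mulr0.
  by case/eqP: ner; apply: matchM.2 Mr Mr'.
case: existsP => [[c Mrc]|M0]; last first.
  apply: big1 => c _; have [->|Mrc] := eqVneq (M r c) 0; first by rewrite mul0r.
  by case: M0; exists c.
rewrite (bigD1 c) //= mxE divff // big1 ?addr0 // => c' nec.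
have [->|Mrc'] := eqVneq (M r c') 0; first by rewrite mul0r.
by rewrite (matchM.1 _ _ _ Mrc Mrc') eqxx in nec.
Qed.

Lemma col_projE c c' :
  (matching_pinv *m M) c c' = ((c == c') && [exists r, M r c != 0])%:R.
Proof.
rewrite mxE; have [<-{c'}|nec] /= := eqVneq; last first.
  apply: big1 => r _; rewrite mxE; have [->|Mc'] := eqVneq (M r c') 0.
    by rewrite mulr0.
  have [->|Mc] := eqVneq (M r c) 0; first by rewrite invr0 mul0r.
  by case/eqP: nec; apply: matchM.1 Mc Mc'.
case: existsP => [[r Mrc]|M0]; last first.
  apply: big1 => r _; have [->|Mrc] := eqVneq (M r c) 0; first by rewrite mulr0.
  by case: M0; exists r.
rewrite (bigD1 r) //= mxE mulVf // big1 ?addr0 // => r' ner.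
have [->|Mrc'] := eqVneq (M r' c) 0; first by rewrite mulr0.
by rewrite (matchM.2 _ _ _ Mrc Mrc') eqxx in ner.
Qed.

Lemma null_rowsE r r' :
  null_rows r r' = ((r == r') && (r \notin nzrows M))%:R.
Proof.
rewrite mxE [X in _ + X]mxE row_projE mxE.
by case: (r == r'); case: (r \in _); rewrite ?subrr ?subr0.
Qed.

Lemma null_colsE c c' :
  null_cols c c' = ((c == c') && ~~ [exists r, M r c != 0])%:R.
Proof.
rewrite mxE [X in _ + X]mxE col_projE mxE.
by case: (c == c'); case: [exists r, _]; rewrite ?subrr ?subr0.
Qed.

(** The program stores only the diagonal of [I'] and the [k]-th unit vector; their entrywise product
    is column [k] of [I']. Indices are compared as natural numbers, as in memory. *)
Lemma null_rows_delta (r k : 'I_m) :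
  null_rows r r * ((r : nat) == k)%:R = null_rows r k.
Proof.
rewrite !null_rowsE eqxx -[(r : nat) == k]/(r == k).
by case: eqP => _; rewrite ?mulr1 ?mulr0.
Qed.

Lemma null_rows_sym r k : null_rows r k = null_rows k r.
Proof. by rewrite !null_rowsE eq_sym; case: eqP => // ->. Qed.

Lemma null_cols_delta (c k : 'I_n) :
  null_cols c c * ((c : nat) == k)%:R = null_cols c k.
Proof.
rewrite !null_colsE eqxx -[(c : nat) == k]/(c == k).
by case: eqP => _; rewrite ?mulr1 ?mulr0.
Qed.

Lemma null_cols_sym c k : null_cols c k = null_cols k c.
Proof. by rewrite !null_colsE eq_sym; case: eqP => // ->. Qed.

Lemma null_rows_mulmx p (A : 'M[K]_(m, p)) r j :
  (null_rows *m A) r j = null_rows r r * A r j.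
Proof.
rewrite mxE (bigD1 r) //= big1 ?addr0 // => i neir.
by rewrite null_rowsE eq_sym (negPf neir) mul0r.
Qed.

Lemma pinv_mulmxK : M *m matching_pinv *m M = M.
Proof.
apply/matrixP => r c; rewrite mxE (bigD1 r) //= big1 ?addr0 => [|i neir].
  rewrite row_projE eqxx mem_nzrows; case: existsP => [_|M0]; rewrite ?mul1r //.
  have [->|Mrc] := eqVneq (M r c) 0; first by rewrite mulr0.
  by case: M0; exists c.
by rewrite row_projE eq_sym (negPf neir) mul0r.
Qed.

(** Condition (A2) as a matrix equation. *)
Lemma mulmx_null_rows : R *m null_rows = null_rows.
Proof.
case: properRMDC => _ _ colR; apply/matrixP => r r'.
rewrite mxE (bigD1 r') //= big1 ?addr0 => [|i nei]; last first.
  by rewrite null_rowsE (negPf nei) mulr0.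
rewrite !null_rowsE eqxx /= !inE !negbK.
have [/eqP Mr'0 | Mr'] := boolP (row r' M == 0); last first.
  rewrite mulr0; have [err'|//] := eqVneq r r'.
  by rewrite err' (negPf Mr').
have /colP/(_ r) := colR r' Mr'0; rewrite !mxE eqxx andbT mulr1 => ->.
by have [->|//] := eqVneq r r'; rewrite Mr'0 eqxx.
Qed.

(** Condition (A1) as a matrix equation. *)
Lemma null_cols_mulmx : null_cols *m C = null_cols.
Proof.
case: properRMDC => _ rowC _; apply/matrixP => c c'.
rewrite mxE (bigD1 c) //= big1 ?addr0 => [|i nei]; last first.
  by rewrite null_colsE eq_sym (negPf nei) mul0r.
rewrite !null_colsE eqxx /=.
case: existsP => [|M0]; rewrite ?andbF ?mul0r //= mul1r andbT.
have /rowC/rowP/(_ c'): col c M = 0.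
  apply/colP => r; rewrite !mxE.
  by have [//|Mrc] := eqVneq (M r c) 0; case: M0; exists r.
by rewrite !mxE eqxx /= eq_sym.
Qed.

Lemma rho_incl_trmxK : rho_incl^T *m rho_incl = 1%:M.
Proof.
apply/matrixP => i j; rewrite !mxE (bigD1 (rho i)) //= big1 ?addr0 => [|r ner].
  by rewrite !mxE eqxx mul1r (inj_eq enum_val_inj).
by rewrite !mxE (negPf ner) mul0r.
Qed.

Lemma rho_incl_mul_trmx : rho_incl *m rho_incl^T = M *m matching_pinv.
Proof.
apply/matrixP => r r'; rewrite row_projE mxE.
have [Mr|Mr] /= := boolP (r \in nzrows M); last first.
  rewrite andbF big1 // => i _; rewrite !mxE.
  have [er|] := eqVneq r (rho i); last by rewrite mul0r.
  by rewrite er /rho enum_valP in Mr.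
rewrite andbT -[r](enum_rankK_in Mr Mr); set i := enum_rank_in _ _.
rewrite (bigD1 i) //= big1 ?addr0 => [|j nej]; rewrite !mxE /rho.
  by rewrite eqxx mul1r eq_sym.
by rewrite (inj_eq enum_val_inj) eq_sym (negPf nej) mul0r.
Qed.

Lemma rhorhoE : rhorho M R = rho_incl^T *m R *m rho_incl.
Proof.
apply/matrixP => i j; rewrite !mxE (bigD1 (rho j)) //= big1 ?addr0 => [|r ner].
  rewrite !mxE eqxx mulr1 (bigD1 (rho i)) //= big1 ?addr0 => [|r ner].
    by rewrite !mxE eqxx mul1r.
  by rewrite !mxE (negPf ner) mul0r.
by rewrite !mxE (negPf ner) mulr0.
Qed.

Let Runit := upper_unitri_unitmx unitriR.
Let Cunit := upper_unitri_unitmx unitriC.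

Lemma null_rows_rho_inv : null_rows *m rho_inv = 0.
Proof.
rewrite /null_rows /rho_inv mulmxBl mul1mx -rho_incl_mul_trmx !mulmxA.
by rewrite -[rho_incl *m _ *m rho_incl]mulmxA rho_incl_trmxK mulmx1 subrr.
Qed.

(* The columns of [R] outside [rho] are unit columns, so the [rho]-[rho] block
   of [R^-1] inverts [R_rhorho]. *)
Lemma rhorho_unitmx : rhorho M R \in unitmx.
Proof.
have: rhorho M R *m (rho_incl^T *m invmx R *m rho_incl) = 1%:M.
  rewrite rhorhoE !mulmxA -[_ *m rho_incl *m rho_incl^T]mulmxA rho_incl_mul_trmx.
  have ->: M *m matching_pinv = 1%:M - null_rows by rewrite subKr.
  rewrite mulmxBr mulmx1 -[rho_incl^T *m R *m _]mulmxA mulmx_null_rows.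
  have -> : rho_incl^T *m null_rows = 0.
    by rewrite mulmxBr mulmx1 -rho_incl_mul_trmx mulmxA rho_incl_trmxK mul1mx subrr.
  by rewrite subr0 -[_ *m R *m _]mulmxA mulmxV // mulmx1 rho_incl_trmxK.
by case/mulmx1_unit.
Qed.

(** Only the [rho]-[rho] block of [R] survives between the inclusions, and it cancels against its
    inverse. *)
Lemma rho_inv_mulmxR : rho_inv *m R *m (M *m matching_pinv) = M *m matching_pinv.
Proof.
rewrite /rho_inv -rho_incl_mul_trmx !mulmxA.
rewrite -[_ *m rho_incl^T *m R]mulmxA -[_ *m _ *m rho_incl]mulmxA -rhorhoE.
by rewrite -[X in X *m _ = _]mulmxA mulVmx ?rhorho_unitmx // mulmx1.
Qed.

Lemma mulmxR_rho_inv : M *m matching_pinv *m R *m rho_inv = M *m matching_pinv.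
Proof.
rewrite /rho_inv -rho_incl_mul_trmx !mulmxA.
rewrite -[rho_incl *m _ *m R]mulmxA -[_ *m _ *m rho_incl]mulmxA -rhorhoE.
by rewrite -[X in X *m _ = _]mulmxA mulmxV ?rhorho_unitmx // mulmx1.
Qed.

(** A left inverse suffices. [I'' C = I''] and [S D C = S R M = S R (M M^+) M = M], so the product
    with [C] is [I'' + M^+ M = 1]. *)
Lemma invmx_C_E : invmx C = null_cols + matching_pinv *m rho_inv *m D.
Proof.
suff AC1 : (null_cols + matching_pinv *m rho_inv *m D) *m C = 1%:M.
  by rewrite -[RHS](mulmxK Cunit) AC1 mul1mx.
rewrite mulmxDl null_cols_mulmx -mulmxA -RM_DC -pinv_mulmxK.
rewrite -[_ *m rho_inv *m _]mulmxA [R *m _]mulmxA [rho_inv *m (_ *m M)]mulmxA.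
by rewrite [rho_inv *m _]mulmxA rho_inv_mulmxR pinv_mulmxK subrK.
Qed.

(** [D C M^+ = R M M^+ = R (1 - I') = R - I']. *)
Lemma R_E : R = null_rows + D *m C *m matching_pinv.
Proof.
rewrite -RM_DC -mulmxA -[X in X + _]mulmx_null_rows -mulmxDr.
by rewrite subrK mulmx1.
Qed.

(** With [B] the right-hand side, [R I' = I'] gives [R B = I' - I' R S + R S = I' + M M^+ R S = I' +
    M M^+ = 1]. *)
Lemma invmx_R_E :
  invmx R = null_rows *m (1%:M - D *m C *m matching_pinv *m rho_inv) + rho_inv.
Proof.
rewrite -RM_DC; set B := RHS.
suff RB1 : R *m B = 1%:M by rewrite -[RHS](mulKmx Runit) RB1 mulmx1.
rewrite /B mulmxDr mulmxA mulmx_null_rows mulmxBr mulmx1.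
(* [M M^+ S = S], because [I' S = 0]. *)
have -> : R *m M *m matching_pinv *m rho_inv = R *m rho_inv.
  rewrite -[R *m M *m _]mulmxA -[X in R *m X](subKr 1%:M) mulmxBr mulmx1.
  by rewrite mulmxBl -[R *m _ *m _]mulmxA null_rows_rho_inv mulmx0 subr0.
rewrite addrAC -addrA -{1}[R *m rho_inv]mul1mx -mulmxBl subKr.
by rewrite mulmxA mulmxR_rho_inv subrK.
Qed.

(** * Entries of [S] and [M^+ S] by table lookup *)

Lemma entryE p q (A : 'M[K]_(p, q)) (i : 'I_p) (j : 'I_q) : entry A i j = A i j.
Proof. by rewrite /entry !valK. Qed.

Lemma entry_out_row p q (A : 'M[K]_(p, q)) i j : (p <= i)%N -> entry A i j = 0.
Proof. by move=> lepi; rewrite /entry insubF // ltnNge lepi. Qed.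

Lemma entry_out_col p q (A : 'M[K]_(p, q)) i j : (q <= j)%N -> entry A i j = 0.
Proof.
by move=> leqj; rewrite /entry (insubF _ (x := j)) ?ltnNge ?leqj //; case: insub.
Qed.

(** A position outside the range of [invmx (rhorho M R)] reads as 0, which is exactly the extension
    by zeros in [S]; the lookup thus makes no case distinction. *)
Lemma rho_inv_entry (pos : nat -> nat) r r' :
  (forall i, pos (rho (M := M) i) = i) ->
  (forall k : 'I_m, k \notin nzrows M -> (#|nzrows M| <= pos k)%N) ->
  rho_inv r r' = entry (invmx (rhorho M R)) (pos r) (pos r').
Proof.
move=> pos_rho pos_out; rewrite mxE.
have [Mr'|Mr'] := boolP (r' \in nzrows M); last first.
  rewrite entry_out_col ?pos_out //; apply: big1 => i _; rewrite !mxE.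
  by case: eqP Mr' => [->|_ _]; [rewrite /rho enum_valP | rewrite mulr0].
rewrite -[r'](enum_rankK_in Mr' Mr'); set i' := enum_rank_in _ _.
rewrite (bigD1 i') //= big1 ?addr0 => [|j nej]; last first.
  by rewrite !mxE /rho (inj_eq enum_val_inj) eq_sym (negPf nej) mulr0.
rewrite [rho_incl^T _ _]mxE [rho_incl _ _]mxE eqxx mulr1 mxE -/(rho _) pos_rho.
have [Mr|Mr] := boolP (r \in nzrows M); last first.
  rewrite entry_out_row ?pos_out //; apply: big1 => i _; rewrite !mxE.
  by case: eqP Mr => [->|_ _]; [rewrite /rho enum_valP | rewrite mul0r].
rewrite -[r](enum_rankK_in Mr Mr); set i := enum_rank_in _ _.
rewrite (bigD1 i) //= big1 ?addr0 => [|j nej]; last first.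
  by rewrite !mxE /rho (inj_eq enum_val_inj) eq_sym (negPf nej) mul0r.
by rewrite [rho_incl _ _]mxE eqxx mul1r -/(rho _) pos_rho entryE.
Qed.

(** The position in [rho] as a running count, the form in which the program computes it. *)
Definition rho_rank k := count (mem (nzrows M)) (take k (enum 'I_m)).

Lemma rho_rankK i : rho_rank (rho (M := M) i) = i.
Proof.
set r := rho i; have Mr : r \in nzrows M by exact: enum_valP.
have -> : val i = index r (enum (mem (nzrows M))).
  rewrite /r /rho (enum_val_nth r) index_uniq ?enum_uniq //.
  by rewrite -cardE.
have szr : (r < size (enum 'I_m))%N by rewrite size_enum_ord.
have -> : enum (mem (nzrows M)) = [seq x <- enum 'I_m | x \in nzrows M].
  by rewrite [enum 'I_m]enumT.
(* Split at [r]: the members of [rho] before it form a prefix of length [rho_rank r], and [r] heads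
   the rest. *)
rewrite -[enum 'I_m](cat_take_drop r) filter_cat index_cat mem_filter.
rewrite (drop_nth r) // nth_ord_enum /= Mr /=.
rewrite eqxx addn0 ifN ?size_filter //.
apply/negP => /(nthP r)[k]; rewrite size_take szr => ltkr.
rewrite nth_take // => nkr; have := nth_enum_ord r (ltn_trans ltkr (ltn_ord r)).
by rewrite nkr => rk; rewrite -rk ltnn in ltkr.
Qed.

Lemma rho_rankS (k : 'I_m) : rho_rank k.+1 = (rho_rank k + (k \in nzrows M))%N.
Proof.
rewrite /rho_rank (take_nth k) ?size_enum_ord // -cats1 count_cat nth_ord_enum /=.
by rewrite addn0.
Qed.

(** Row [c] of [M^+] has at most one nonzero entry, so row [c] of [M^+ S] is a multiple of one row
    of [S] and each entry costs constant time. For a zero column [mu c = 0], whatever [rowof c]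
    is. *)
Lemma pinv_rho_inv_entry (rowof : nat -> nat) (mu : nat -> K) (pos : nat -> nat)
    (c : 'I_n) (r' : 'I_m) :
  (forall i, pos (rho (M := M) i) = i) ->
  (forall k : 'I_m, k \notin nzrows M -> (#|nzrows M| <= pos k)%N) ->
  (forall r : 'I_m, M r c != 0 -> rowof c = r) ->
  mu c = \sum_r (M r c)^-1 ->
  (matching_pinv *m rho_inv) c r'
    = mu c * entry (invmx (rhorho M R)) (pos (rowof c)) (pos r').
Proof.
move=> pos_rho pos_out rowofP ->; rewrite mxE.
case: (pickP (fun r => M r c != 0)) => [r Mrc|M0]; last first.
  have {}M0 r : M r c = 0 by have /negbFE/eqP := M0 r.
  rewrite [in RHS]big1 ?mul0r => [|r _]; last by rewrite M0 invr0.
  by apply: big1 => r _; rewrite mxE M0 invr0 mul0r.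
have M0 i : i != r -> M i c = 0.
  by move=> ner; apply: contraNeq ner => Mic; rewrite (matchM.2 _ _ _ Mic Mrc).
rewrite (rowofP r) // (bigD1 r) //= big1 ?addr0 => [|i /M0 Mi0]; last first.
  by rewrite mxE Mi0 invr0 mul0r.
rewrite [in RHS](bigD1 r) //= [in RHS]big1 ?addr0 => [|i /M0 ->]; last first.
  by rewrite invr0.
by rewrite mxE (rho_inv_entry _ _ pos_rho pos_out).
Qed.

End Reconstruction.

(** * Verified program blocks *)

(* [csize p * T] bounds the running time of [p] when [T > 0] bounds the product
   of the iteration counts of nested loops; the factor 2 at a loop pays for its
   last, failing test. *)
Fixpoint csize (p : cmd) : nat :=
  match p with
  | CSkip => 1
  | CISet _ e => (icost e).+1
  | CFSet _ e => (fcost e).+1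
  | CIPut _ i e => (icost i + icost e).+1
  | CFPut _ i e => (icost i + fcost e).+1
  | CSeq p1 p2 => (csize p1 + csize p2).+1
  | CIf b p1 p2 => (bcost b + csize p1 + csize p2).+1
  | CWhile b p1 => (bcost b + csize p1).+1.*2
  end.

Definition For i b body :=
  CSeq (CISet i IZero)
    (CWhile (BLt (IVar i) (IVar b)) (CSeq body (CISet i (ISucc (IVar i))))).

(* Field register 0 is the accumulator. *)
Definition SumInto b e :=
  CSeq (CFSet 0 FZero) (For 4 b (CFSet 0 (FAdd (FVar 0) e))).

(** The shape of a matrix-vector product: register 3 is the output index, 4 the summation index, and
    [e2] finishes off the sum left in field register 0. *)
Definition Tabulate A b1 b2 e1 e2 :=
  For 3 b1 (CSeq (SumInto b2 e1) (CFPut A (IVar 3) e2)).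

(** The update of [z] by the unknown just found, [z := z + x q]. *)
Definition Axpy q :=
  For 4 0 (CFPut 2 (IVar 4) (FAdd (FGet 2 (IVar 4)) (FMul q (FGet 3 (IVar 5))))).

(* Index register 5 holds the current unknown, array 1 the right-hand side,
   array 2 the vector [z] and array 3 the unknowns. *)
Definition Solve ord p q :=
  For 3 1
    (CSeq (CISet 5 ord)
    (CSeq (SumInto 0 (FMul p (FGet 2 (IVar 4))))
    (CSeq (CFPut 3 (IVar 5) (FAdd (FGet 1 (IVar 5)) (FOpp (FVar 0))))
      (Axpy q)))).

(** * Timed total-correctness rules *)

Section Runs.
Variables (K : fieldType) (inp : input_name -> nat -> nat -> K).
Implicit Types (s : store K) (Q : store K -> Prop) (p : cmd).

(** A total-correctness triple with running time. The factor [csize p] depends on the syntax alone,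
    so the final constant is uniform in the field and the dimensions. *)
Definition runs T p s Q :=
  exists t s', [/\ exec inp p s t s', t <= csize p * T & Q s'].

Lemma runs_conseq T T' p s Q Q' :
  runs T p s Q -> T <= T' -> (forall s', Q s' -> Q' s') -> runs T' p s Q'.
Proof.
move=> [t [s' [ex le_t Qs']]] leT QQ'; exists t, s'; split=> //; last exact: QQ'.
by rewrite (leq_trans le_t) // leq_mul2l leT orbT.
Qed.

Lemma runs_seq T p1 p2 s Q1 Q :
  0 < T -> runs T p1 s Q1 -> (forall s1, Q1 s1 -> runs T p2 s1 Q) ->
  runs T (CSeq p1 p2) s Q.
Proof.
move=> T0 [t1 [s1 [ex1 le1 /[swap]/[apply]]]] [t2 [s2 [ex2 le2 Qs2]]].
exists (t1 + t2).+1, s2; split=> //; first exact: ExSeq ex1 ex2.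
by rewrite /= mulSn mulnDl; lia.
Qed.

Lemma runs_if T b p1 p2 s Q :
  0 < T -> (beval inp s b -> runs T p1 s Q) -> (~~ beval inp s b -> runs T p2 s Q) ->
  runs T (CIf b p1 p2) s Q.
Proof.
move=> T0; have [sb /(_ isT) r1 _|sb _ /(_ isT) r2] := boolP (beval inp s b).
  case: r1 => t [s' [ex le_t Qs']].
  exists (bcost b + t).+1, s'; split=> //; first exact: ExIfTrue.
  by rewrite /= mulSn !mulnDl; have := leq_pmulr (bcost b) T0; lia.
case: r2 => t [s' [ex le_t Qs']].
exists (bcost b + t).+1, s'; split=> //; first exact: ExIfFalse.
by rewrite /= mulSn !mulnDl; have := leq_pmulr (bcost b) T0; lia.
Qed.

Lemma runs_skip T s Q : 0 < T -> Q s -> runs T CSkip s Q.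
Proof. by exists 1, s; split; [constructor | rewrite leq_pmulr |]. Qed.

Lemma runs_iset T x e s Q :
  0 < T -> Q (set_ivar s x (ieval s e)) -> runs T (CISet x e) s Q.
Proof. by eexists _, _; split; [constructor | rewrite leq_pmulr |]. Qed.

Lemma runs_fset T x e s Q :
  0 < T -> Q (set_fvar s x (feval inp s e)) -> runs T (CFSet x e) s Q.
Proof. by eexists _, _; split; [constructor | rewrite leq_pmulr |]. Qed.

Lemma runs_iput T a i e s Q :
  0 < T -> Q (put_iarr s a (ieval s i) (ieval s e)) -> runs T (CIPut a i e) s Q.
Proof. by eexists _, _; split; [constructor | rewrite leq_pmulr |]. Qed.

Lemma runs_fput T a i e s Q :
  0 < T -> Q (put_farr s a (ieval s i) (feval inp s e)) -> runs T (CFPut a i e) s Q.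
Proof. by eexists _, _; split; [constructor | rewrite leq_pmulr |]. Qed.

(** The invariant fixes the counter and the bound register, which decide the test. *)
Lemma runs_for T i b B body s (I : nat -> store K -> Prop) :
  0 < T -> 0 < B ->
  (forall a s1, I a s1 -> ivar s1 i = a /\ ivar s1 b = B) ->
  I 0 (set_ivar s i 0) ->
  (forall (a : 'I_B) s1, I a s1 ->
    runs T body s1 (fun s2 => ivar s2 i = a /\ I a.+1 (set_ivar s2 i a.+1))) ->
  runs (B * T) (For i b body) s (I B).
Proof.
move=> T0 B0 Ireg I0 Ibody.
have {}Ibody (a : 'I_B) s1 : I a s1 ->
    runs T (CSeq body (CISet i (ISucc (IVar i)))) s1 (I a.+1).
  move=> /Ibody run; apply: (runs_seq T0 run) => s2 [ia Is2].
  by apply: runs_iset => //=; rewrite ia.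
set body' := CSeq body _ in Ibody.
(* [d] counts the remaining turns. The first 4 is the failing last test, the second the successful
   test of each turn. *)
have {}Ibody d a s1 : a + d = B -> I a s1 -> exists t s2,
    [/\ exec inp (CWhile (BLt (IVar i) (IVar b)) body') s1 t s2,
        t <= 4 + d * (4 + csize body' * T) & I B s2].
  elim: d a s1 => [|d IHd] a s1 eB Ias1; have [ia bB] := Ireg _ _ Ias1.
    exists 4, s1; split=> //; last by rewrite -eB addn0.
    by apply: ExWhileFalse; rewrite /= ia bB -eB addn0 ltnn.
  have lta : a < B by rewrite -eB addnS ltnS leq_addr.
  have [t1 [s2 [ex1 le1 Is2]]] := Ibody (Ordinal lta) _ Ias1.
  have [|t2 [s3 [ex2 le2 Is3]]] := IHd a.+1 s2 _ Is2; first by rewrite -eB addnS.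
  exists (3 + t1 + t2).+1, s3; split=> //; last by rewrite mulSn; lia.
  by apply: ExWhileTrue ex1 ex2; rewrite /= ia bB.
have [t [s' [ex le_t Is']]] := Ibody B 0 _ erefl I0.
exists (2 + t).+1, s'; split=> //.
  by apply: ExSeq ex; exact: (ExISet inp s i IZero).
(* 7 is 4 plus the initial assignment and the sequencing. With [k] and [X] as below, [1 <= X] and
   [B <= X] give [7 + 4 B + k X <= (11 + 2 k) X]. *)
apply: leq_trans (_ : 7 + B * (4 + csize body' * T) <= _); first by lia.
have BT0 : 0 < B * T by rewrite muln_gt0 B0.
have leBT : B <= B * T by rewrite leq_pmulr.
set k := csize body' in le_t *; set X := B * T in BT0 leBT *.
have -> : csize (For i b body) = 11 + 2 * k by rewrite /k /=; lia.
have -> : B * (4 + k * T) = 4 * B + k * X by rewrite mulnDr mulnCA mulnC.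
rewrite mulnDl -mulnA; lia.
Qed.

End Runs.

(** * Frame conditions on the store *)

Section Agree.
Variable K : fieldType.
Implicit Types (s : store K) (V F J : seq nat).

(* [V], [F] and [J] list the index registers, field arrays and index arrays
   that may have changed; field registers are never preserved. *)
Definition agree V F J s s' :=
  [/\ forall x, x \notin V -> ivar s' x = ivar s x,
      forall a, a \notin F -> farr s' a = farr s a &
      forall a, a \notin J -> iarr s' a = iarr s a].

Lemma agree_trans V F J s1 s2 s3 :
  agree V F J s1 s2 -> agree V F J s2 s3 -> agree V F J s1 s3.
Proof.
move=> [v f j] [v' f' j']; split=> a na.
- by rewrite v' ?v.
- by rewrite f' ?f.
- by rewrite j' ?j.
Qed.

Lemma agree_sub V F J V' F' J' s s' :
  agree V F J s s' -> {subset V <= V'} -> {subset F <= F'} -> {subset J <= J'} ->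
  agree V' F' J' s s'.
Proof.
move=> [v f j] sV sF sJ; split=> a na; first by rewrite v // (contra (@sV a)).
  by rewrite f // (contra (@sF a)).
by rewrite j // (contra (@sJ a)).
Qed.

Lemma agree_ivar V F J s s' x v :
  x \in V -> agree V F J s s' -> agree V F J s (set_ivar s' x v).
Proof.
move=> Vx [Hv Hf Hj]; split=> // y ny /=; rewrite /upd.
by case: eqP ny => [->|_ /Hv //]; rewrite Vx.
Qed.

Lemma agree_farr V F J s s' a i v :
  a \in F -> agree V F J s s' -> agree V F J s (put_farr s' a i v).
Proof.
move=> Fa [Hv Hf Hj]; split=> // y ny /=; rewrite /upd.
by case: eqP ny => [->|_ /Hf //]; rewrite Fa.
Qed.

Lemma agree_iarr V F J s s' a i v :
  a \in J -> agree V F J s s' -> agree V F J s (put_iarr s' a i v).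
Proof.
move=> Ja [Hv Hf Hj]; split=> // y ny /=; rewrite /upd.
by case: eqP ny => [->|_ /Hj //]; rewrite Ja.
Qed.

End Agree.

(** * Loops for sums, matrix-vector products and substitution *)

Section Blocks.
Variables (K : fieldType) (inp : input_name -> nat -> nat -> K).
Implicit Types s : store K.

Lemma runs_sum (b : nat) B (e : fexp) s (E : 'I_B -> K) :
  b != 4 -> 0 < B -> ivar s b = B ->
  (forall (i : 'I_B) s', agree [:: 4] [::] [::] s s' -> ivar s' 4 = i ->
     feval inp s' e = E i) ->
  runs inp B (SumInto b e) s
    (fun s' => agree [:: 4] [::] [::] s s' /\ fvar s' 0 = (\sum_i E i)%R).
Proof.
move=> b4 B0 bB evE.
apply: (runs_seq (Q1 := eq^~ (set_fvar s 0 0%R))) => //; first exact: runs_fset.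
move=> s1 ->; apply: (runs_conseq (T := B * 1) (Q := fun s' => [/\ agree [:: 4] [::] [::] s s',
  ivar s' 4 = B & fvar s' 0 = (\sum_(i < B | (i < B)%N) E i)%R])); rewrite ?muln1 //; last first.
  by move=> s' [? _ ->]; split=> //; apply: eq_bigl => i; rewrite ltn_ord.
rewrite -[X in runs _ X]muln1.
apply: (runs_for (I := fun a s' => [/\ agree [:: 4] [::] [::] s s',
  ivar s' 4 = a & fvar s' 0 = (\sum_(i < B | (i < a)%N) E i)%R])) => //.
- by move=> a s2 [[v _ _] -> _]; split=> //; rewrite v ?inE.
- by split=> //=; [apply: agree_ivar | rewrite big1].
move=> a s2 [ag ia sa]; apply: runs_fset => //; split=> //=.
split=> //=; first exact: agree_ivar.
rewrite /upd /= sa (evE a) // [RHS](bigD1 a) //= addrC; congr (_ + _)%R.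
by apply: eq_bigl => i; rewrite ltnS [RHS]andbC ltn_neqAle.
Qed.

Lemma runs_tabulate A b1 b2 B1 B2 e1 e2 s (E : 'I_B1 -> 'I_B2 -> K)
    (f : 'I_B1 -> K) :
  b1 \notin [:: 3; 4] -> b2 \notin [:: 3; 4] ->
  0 < B1 -> 0 < B2 -> ivar s b1 = B1 -> ivar s b2 = B2 ->
  (forall (a : 'I_B1) (i : 'I_B2) s', agree [:: 3; 4] [:: A] [::] s s' ->
     ivar s' 3 = a -> ivar s' 4 = i -> feval inp s' e1 = E a i) ->
  (forall (a : 'I_B1) s', agree [:: 3; 4] [:: A] [::] s s' ->
     ivar s' 3 = a -> fvar s' 0 = (\sum_i E a i)%R -> feval inp s' e2 = f a) ->
  runs inp (B1 * B2) (Tabulate A b1 b2 e1 e2) s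
    (fun s' => agree [:: 3; 4] [:: A] [::] s s' /\
               forall a : 'I_B1, farr s' A a = f a).
Proof.
move=> b1V b2V B10 B20 b1B b2B ev1 ev2.
apply: (runs_conseq (T := B1 * B2) (Q := fun s' => [/\ agree [:: 3; 4] [:: A] [::] s s',
  ivar s' 3 = B1 & forall a : 'I_B1, a < B1 -> farr s' A a = f a])) => //; last first.
  by move=> s' [ag _ fE]; split=> // a; apply: fE.
apply: (runs_for (I := fun j s' => [/\ agree [:: 3; 4] [:: A] [::] s s',
  ivar s' 3 = j & forall a : 'I_B1, a < j -> farr s' A a = f a])) => //.
- by move=> a s1 [[v _ _] -> _]; split=> //; rewrite v.
- by split=> //=; apply: agree_ivar.
move=> a s1 [ag ia fE]; apply: runs_seq => //.
  apply: (runs_sum (E := E a)) => //.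
  - by move: b2V; rewrite !inE negb_or => /andP[].
  - by case: ag => v _ _; rewrite v.
  move=> i s' ag' i4; apply: ev1 => //; last first.
    by case: ag' => v _ _; rewrite v ?inE.
  apply: agree_trans ag _; apply: agree_sub ag' _ _ _ => // x.
  by rewrite !inE => ->; rewrite orbT.
move=> s2 [ag' sumE].
have ag2 : agree [:: 3; 4] [:: A] [::] s s2.
  apply: agree_trans ag _; apply: agree_sub ag' _ _ _ => // x.
  by rewrite !inE => ->; rewrite orbT.
have ia2 : ivar s2 3 = a by case: ag' => v _ _; rewrite v ?inE.
apply: runs_fput => //; split=> //; split=> //=.
  by apply: agree_ivar; rewrite ?inE //; apply: agree_farr; rewrite ?inE.
move=> j; rewrite ltnS /upd eqxx ia2 leq_eqVlt.
have [ja _|neja /= ltja] := eqVneq (val j) (val a).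
  by rewrite (val_inj ja); apply: ev2.
by case: ag' => _ -> // _; apply: fE.
Qed.

Lemma runs_axpy m q s (Q Z : 'I_m -> K) (x : K) :
  0 < m -> ivar s 0 = m ->
  (forall (r : 'I_m) s', agree [:: 4] [:: 2] [::] s s' -> ivar s' 4 = r ->
     feval inp s' q = Q r) ->
  (forall r : 'I_m, farr s 2 r = Z r) -> farr s 3 (ivar s 5) = x ->
  runs inp m (Axpy q) s
    (fun s' => agree [:: 4] [:: 2] [::] s s' /\
               forall r : 'I_m, farr s' 2 r = (Z r + Q r * x)%R).
Proof.
move=> m0 s0 evq Z0 x0.
apply: (runs_conseq (T := m * 1) (Q := fun s' => [/\ agree [:: 4] [:: 2] [::] s s',
  ivar s' 4 = m & forall i : 'I_m,
    farr s' 2 i = (if (i < m)%N then Z i + Q i * x else Z i)%R])); rewrite ?muln1 //.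
  rewrite -[X in runs _ X]muln1.
  apply: (runs_for (I := fun a s' => [/\ agree [:: 4] [:: 2] [::] s s',
    ivar s' 4 = a & forall i : 'I_m,
      farr s' 2 i = (if (i < a)%N then Z i + Q i * x else Z i)%R])) => //.
  - by move=> a s1 [[v _ _] -> _]; split=> //; rewrite v.
  - by split=> //; apply: agree_ivar.
  move=> a s1 [ag ia zE]; apply: runs_fput => //; split=> //; split=> //.
    by apply: agree_ivar => //; apply: agree_farr.
  move=> i; rewrite /= /upd /= ia ltnS leq_eqVlt -[(i : nat) == a]/(i == a).
  have [->|_] /= := eqVneq i a; last exact: zE.
  rewrite zE ltnn (evq a) //; congr (_ + _ * _)%R.
  by rewrite -x0; case: ag => v f _; rewrite v // f.
by move=> s' [ag _ zE]; split=> // r; rewrite zE ltn_ord.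
Qed.

(** Invariant: array 2 holds the combination of the [Q (o i)] over the solved [i], and array 3 the
    unknowns found. A turn is one scalar product and one update, both linear in [m]. *)
Lemma runs_solve m n ord p q s (o : 'I_n -> 'I_n) (P Q : 'I_n -> 'I_m -> K)
    (b X : 'I_n -> K) :
  0 < m -> 0 < n -> ivar s 0 = m -> ivar s 1 = n -> injective o ->
  (forall (j : 'I_n) s', agree [:: 3; 4; 5] [:: 2; 3] [::] s s' ->
     ivar s' 3 = j -> ieval s' ord = o j) ->
  (forall (c : 'I_n) (r : 'I_m) s', agree [:: 3; 4; 5] [:: 2; 3] [::] s s' ->
     ivar s' 5 = c -> ivar s' 4 = r ->
     feval inp s' p = P c r /\ feval inp s' q = Q c r) ->
  (forall r : 'I_m, farr s 2 r = 0%R) -> (forall c : 'I_n, farr s 1 c = b c) ->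
  (forall j, X (o j) = b (o j) -
     \sum_r P (o j) r * (\sum_(i < n | (i < j)%N) Q (o i) r * X (o i)))%R ->
  runs inp (n * m) (Solve ord p q) s
    (fun s' => agree [:: 3; 4; 5] [:: 2; 3] [::] s s' /\
               forall j, farr s' 3 (o j) = X (o j)).
Proof.
move=> m0 n0 s0 s1 o_inj evord evpq z0 b0 XE.
apply: (runs_conseq (T := n * m) (Q := fun s' =>
  [/\ agree [:: 3; 4; 5] [:: 2; 3] [::] s s', ivar s' 3 = n,
      forall r : 'I_m, farr s' 2 r = (\sum_(i < n | (i < n)%N) Q (o i) r * X (o i))%R &
      forall i : 'I_n, i < n -> farr s' 3 (o i) = X (o i)])) => //; last first.
  by move=> s' [ag _ _ xE]; split=> // j; apply: xE.
apply: (runs_for (I := fun j s' =>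
  [/\ agree [:: 3; 4; 5] [:: 2; 3] [::] s s', ivar s' 3 = j,
      forall r : 'I_m, farr s' 2 r = (\sum_(i < n | (i < j)%N) Q (o i) r * X (o i))%R &
      forall i : 'I_n, i < j -> farr s' 3 (o i) = X (o i)])) => //.
- by move=> j s' [[v _ _] -> _ _]; split=> //; rewrite v.
- split=> //; first exact: agree_ivar.
  by move=> r; rewrite big1 // -(z0 r).
move=> j t [ag ij zE xE].
apply: (runs_seq (Q1 := eq^~ (set_ivar t 5 (o j)))) => //.
  by apply: runs_iset => //; rewrite (evord j).
move=> t1 ->{t1}; set t1 := set_ivar t 5 (o j).
have ag1 : agree [:: 3; 4; 5] [:: 2; 3] [::] s t1 by apply: agree_ivar.
apply: runs_seq => //.
  apply: (runs_sum (E := fun r : 'I_m => (P (o j) r *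
    (\sum_(i < n | (i < j)%N) Q (o i) r * X (o i)))%R)) => //.
    by case: ag1 => v _ _; rewrite v.
  move=> r t2 ag2 ir /=; case: (ag2) => v2 f2 _; rewrite ir f2 // -zE.
  congr (_ * _)%R; apply: (evpq _ _ _ _ _ ir).1; last by rewrite v2.
  apply: agree_trans ag1 _; apply: agree_sub ag2 _ _ _ => // x.
  by rewrite !inE => ->; rewrite orbT.
move=> t2 [ag2 sumE].
have ag2' : agree [:: 3; 4; 5] [:: 2; 3] [::] s t2.
  apply: agree_trans ag1 _; apply: agree_sub ag2 _ _ _ => // x.
  by rewrite !inE => ->; rewrite orbT.
have i5 : ivar t2 5 = o j by case: ag2 => v _ _; rewrite v.
have i3 : ivar t2 3 = j by case: ag2 => v _ _; rewrite v.
apply: (runs_seq (Q1 := eq^~ (put_farr t2 3 (o j) (X (o j))))) => //.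
  apply: runs_fput => //=; rewrite i5; congr put_farr.
  by case: ag2' => _ f _; rewrite f // b0 sumE XE.
move=> t3 ->{t3}; set t3 := put_farr t2 3 _ _.
have ag3 : agree [:: 3; 4; 5] [:: 2; 3] [::] s t3 by apply: agree_farr.
apply: (runs_conseq (runs_axpy (Q := Q (o j)) (x := X (o j))
  (Z := fun r : 'I_m => (\sum_(i < n | (i < j)%N) Q (o i) r * X (o i))%R) m0 _ _ _ _)) => //.
- by case: ag3 => v _ _; rewrite v.
- move=> r t4 ag4 ir; apply: (evpq _ _ _ _ _ ir).2.
    apply: agree_trans ag3 _; apply: agree_sub ag4 _ _ _ => // x.
      by rewrite !inE => ->; rewrite orbT.
    by rewrite !inE => ->.
  by case: ag4 => v _ _; rewrite v.
- by move=> r; rewrite /t3 /= /upd /=; case: ag2 => _ -> // _; apply: zE.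
- by rewrite /t3 /= /upd /= i5 eqxx.
move=> t4 [ag4 zE4]; case: (ag4) => v4 f4 _; split; first by rewrite v4.
split=> //.
- apply: agree_ivar => //; apply: agree_trans ag3 _; apply: agree_sub ag4 _ _ _ => // x.
    by rewrite !inE => ->; rewrite orbT.
  by rewrite !inE => ->.
- move=> r; rewrite [LHS]zE4 [RHS](bigD1 j) //= addrC; congr (_ + _)%R.
  by apply: eq_bigl => i; rewrite ltnS [RHS]andbC ltn_neqAle.
move=> i leij /=; rewrite f4 // /t3 /= /upd /=.
(* [o] is injective, so this turn overwrites no earlier unknown. *)
rewrite -[(o i : nat) == o j]/(o i == o j) (inj_eq o_inj).
have [->//|neij] := eqVneq i j.
by case: ag2 => _ -> // _; apply: xE; rewrite ltn_neqAle neij.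
Qed.

End Blocks.

Section LinearSystem.
Local Open Scope ring_scope.
Variables (K : fieldType) (m n : nat).

(* Back substitution in an order [o] of the unknowns for which [A], equal to
   [P *m Q^T] off the diagonal, is lower unitriangular. *)
Lemma unitriangular_substitution (A : 'M[K]_n) (P Q : 'M[K]_(n, m))
    (o : 'I_n -> 'I_n) (b X : 'I_n -> K) :
  bijective o -> (forall c, A c c = 1) ->
  (forall i j : 'I_n, (j < i)%N -> A (o j) (o i) = 0) ->
  (forall c c', c != c' -> A c c' = \sum_r P c r * Q c' r) ->
  (forall c, \sum_c' A c c' * X c' = b c) ->
  forall j, X (o j) = b (o j) -
    \sum_r P (o j) r * (\sum_(i < n | (i < j)%N) Q (o i) r * X (o i)).
Proof.
move=> o_bij A1 A0 APQ AX j; rewrite -AX (reindex o) /=; last exact: onW_bij.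
rewrite (bigD1 j) //= A1 mul1r -addrA -[LHS]addr0; congr (_ + _).
apply/esym/eqP; rewrite subr_eq0; apply/eqP.
under [RHS]eq_bigr do rewrite mulr_sumr.
(* Triangularity kills the terms with [j < i]; those with [i < j] are off the diagonal, where [A] is
   [P Q^T]. *)
rewrite exchange_big /= [LHS](bigID (fun i : 'I_n => (i < j)%N)) /=.
rewrite [X in _ + X]big1 ?addr0 => [|i /andP[neij]]; last first.
  by rewrite -leqNgt => leji; rewrite A0 ?mul0r // ltn_neqAle eq_sym neij.
apply: eq_big => [i|i /andP[neij _]]; first by rewrite ltn_neqAle andbA andbb.
rewrite APQ ?(inj_eq (bij_inj o_bij)) 1?eq_sym // mulr_suml.
by apply: eq_bigr => r _; rewrite mulrA.
Qed.

End LinearSystem.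

(** * The reconstruction program *)

(* Memory after [Prelude]: field arrays 4, 5, 6 and 7 hold the [k]-th unit
   vector, the indicators of the zero rows and zero columns of [M], and the
   inverses of the nonzero entries of [M] by column; index array 1 maps a
   nonzero column to its matched row, array 2 maps a row to its position in
   [rho] (to [m], which is out of range, if its row is zero), and array 3
   reverses [0, ..., n-1]. *)

Definition M_ i j := FInput InM i j.
Definition D_ i j := FInput InD i j.
Definition Sinv_ i j := FInput InRinv (IGet 2 i) (IGet 2 j).
Definition MpS_ c r := FMul (FGet 7 c) (FInput InRinv (IGet 2 (IGet 1 c)) (IGet 2 r)).

Definition MatchedRows :=
  For 3 1 (For 4 0
    (CIf (BNot (BEqF (M_ (IVar 4) (IVar 3)) FZero))
       (CIPut 1 (IVar 3) (IVar 4)) CSkip)).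

Definition RhoRanks :=
  CSeq (CISet 5 IZero)
    (For 3 0
      (CIf (BEqF (FGet 5 (IVar 3)) FZero)
         (CSeq (CIPut 2 (IVar 3) (IVar 5)) (CISet 5 (ISucc (IVar 5))))
         (CIPut 2 (IVar 3) (IVar 0)))).

(** Index arithmetic has no subtraction, so [n - 1 - j] is tabulated by counting down. *)
Definition Reversal :=
  CSeq (CISet 5 (IVar 1))
    (For 3 1 (CSeq (CISet 5 (IPred (IVar 5))) (CIPut 3 (IVar 3) (IVar 5)))).

(** [x * x^-1] is 1 or 0 as [x] is nonzero or not, which yields the indicators; as [0^-1 = 0], the
    sum of inverses along a nonzero column of [M] is the inverse of its only nonzero entry. *)
Definition Prelude :=
  CSeq (CFPut 4 (IVar 2) FOne)
  (CSeq (Tabulate 5 0 1 (FMul (M_ (IVar 3) (IVar 4)) (FInv (M_ (IVar 3) (IVar 4))))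
           (FAdd FOne (FOpp (FVar 0))))
  (CSeq (Tabulate 6 1 0 (FMul (FInv (M_ (IVar 4) (IVar 3))) (M_ (IVar 4) (IVar 3)))
           (FAdd FOne (FOpp (FVar 0))))
  (CSeq (Tabulate 7 1 0 (FInv (M_ (IVar 4) (IVar 3))) (FVar 0))
  (CSeq MatchedRows (CSeq RhoRanks Reversal))))).

(** The vector to be multiplied by [C]: a unit vector for [C] and [C^-1], row [k] of [D] for rows of
    [R] and [R^-1], column [k] of [M^+] or [M^+ S] for their columns. *)
Definition rhs (t : target) (l : line) : fexp :=
  match t, l with
  | (TC | TCinv), _ => FGet 4 (IVar 3)
  | TR, Col => FInv (M_ (IVar 2) (IVar 3))
  | TRinv, Col => MpS_ (IVar 3) (IVar 2)
  | (TR | TRinv), Row => D_ (IVar 2) (IVar 3)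
  end.

(** As [C^-1] is upper triangular, [x C^-1 = b] is solved from the first unknown on, with
    [z = x M^+ S], and [C^-1 x = b] from the last one back, with [z = D x]. *)
Definition SolveC (l : line) : cmd :=
  match l with
  | Row => Solve (IVar 3) (D_ (IVar 4) (IVar 5)) (MpS_ (IVar 5) (IVar 4))
  | Col => Solve (IGet 3 (IVar 3)) (MpS_ (IVar 5) (IVar 4)) (D_ (IVar 4) (IVar 5))
  end.

Definition out_term (t : target) (l : line) : fexp :=
  match t, l with
  | TC, _ => FZero
  | TCinv, Row => FMul (MpS_ (IVar 2) (IVar 4)) (D_ (IVar 4) (IVar 3))
  | TCinv, Col => FMul (MpS_ (IVar 3) (IVar 4)) (D_ (IVar 4) (IVar 2))
  | TR, Row => FMul (FGet 3 (IVar 4)) (FInv (M_ (IVar 3) (IVar 4)))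
  | TRinv, Row => FMul (FGet 3 (IVar 4)) (MpS_ (IVar 4) (IVar 3))
  | (TR | TRinv), Col => FMul (D_ (IVar 3) (IVar 4)) (FGet 3 (IVar 4))
  end.

Definition out_expr (t : target) (l : line) : fexp :=
  match t with
  | TC => FGet 3 (IVar 3)
  | TCinv => FAdd (FMul (FGet 6 (IVar 3)) (FGet 4 (IVar 3))) (FVar 0)
  | TR => FAdd (FMul (FGet 5 (IVar 3)) (FGet 4 (IVar 3))) (FVar 0)
  | TRinv =>
    match l with
    | Row => FAdd (FMul (FGet 5 (IVar 2)) (FAdd (FGet 4 (IVar 3)) (FOpp (FVar 0))))
               (Sinv_ (IVar 2) (IVar 3))
    | Col => FAdd (FMul (FGet 5 (IVar 3)) (FAdd (FGet 4 (IVar 3)) (FOpp (FVar 0))))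
               (Sinv_ (IVar 3) (IVar 2))
    end
  end.

(** Selects the other dimension, over which the last product sums. *)
Definition transposed (t : target) : target :=
  match t with TR | TRinv => TC | TC | TCinv => TR end.

Definition dim_reg (t : target) : nat :=
  match t with TR | TRinv => 0 | TC | TCinv => 1 end.

Definition reconstruct t l :=
  CSeq Prelude
  (CSeq (Tabulate 1 1 0 FZero (rhs t l))
  (CSeq (SolveC l)
    (Tabulate 0 (dim_reg t) (dim_reg (transposed t)) (out_term t l) (out_expr t l)))).

(** * Correctness *)

Section Correctness.
Variables (K : fieldType) (m n : nat).
Variables (D M : 'M[K]_(m, n)) (R : 'M[K]_m) (C : 'M[K]_n).
Hypothesis properRMDC : proper_umatch R M D C.
Hypotheses (m_gt0 : 0 < m) (n_gt0 : 0 < n).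
Let inp := umatch_inputs D M R.
Implicit Types s : store K.

Record prepared (k : nat) s : Prop := Prepared {
  prep_m : ivar s 0 = m;
  prep_n : ivar s 1 = n;
  prep_k : ivar s 2 = k;
  prep_unit : forall j, farr s 4 j = ((j == k)%:R)%R;
  prep_null_row : forall r : 'I_m, farr s 5 r = null_rows M r r;
  prep_null_col : forall c : 'I_n, farr s 6 c = null_cols M c c;
  prep_pivot_inv : forall c : 'I_n, farr s 7 c = (\sum_r (M r c)^-1)%R;
  prep_matched : forall (r : 'I_m) (c : 'I_n), (M r c != 0)%R -> iarr s 1 c = r;
  prep_rank : forall i, iarr s 2 (rho (M := M) i) = i;
  prep_out : forall r : 'I_m, r \notin nzrows M -> #|nzrows M| <= iarr s 2 r;
  prep_rev : forall j : 'I_n, iarr s 3 j = rev_ord j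
}.

Lemma prepared_agree k s s' :
  prepared k s -> agree [:: 3; 4; 5] [:: 0; 1; 2; 3] [::] s s' -> prepared k s'.
Proof. by move=> [] ? ? ? ? ? ? ? ? ? ? ? [v f j]; split; rewrite ?v ?f ?j. Qed.

Lemma card_nzrows_le : #|nzrows M| <= m.
Proof. by rewrite -[X in _ <= X]card_ord max_card. Qed.

(** * The tables of the prelude *)

Lemma runs_MatchedRows s :
  ivar s 0 = m -> ivar s 1 = n ->
  runs inp (n * m) MatchedRows s (fun s' => agree [:: 3; 4] [::] [:: 1] s s' /\
    forall (r : 'I_m) (c : 'I_n), (M r c != 0)%R -> iarr s' 1 c = r).
Proof.
have matchM : matching_mx M by case: properRMDC => [[]].
move=> s0 s1; apply: (runs_conseq (T := n * m) (Q := fun s' =>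
  [/\ agree [:: 3; 4] [::] [:: 1] s s', ivar s' 3 = n &
      forall (r : 'I_m) (c : 'I_n), c < n -> (M r c != 0)%R -> iarr s' 1 c = r]))
  => //; last by move=> s' [ag _ iE]; split=> // r c; apply: iE.
apply: (runs_for (I := fun j s' =>
  [/\ agree [:: 3; 4] [::] [:: 1] s s', ivar s' 3 = j &
      forall (r : 'I_m) (c : 'I_n), c < j -> (M r c != 0)%R -> iarr s' 1 c = r])) => //.
- by move=> j s' [[v _ _] -> _]; split=> //; rewrite v.
- by split=> //; apply: agree_ivar.
move=> j t [ag ij iE].
apply: (runs_conseq (T := m * 1) (Q := fun s' =>
  [/\ agree [:: 3; 4] [::] [:: 1] s s', ivar s' 3 = j, ivar s' 4 = m,
      forall r : 'I_m, r < m -> (M r j != 0)%R -> iarr s' 1 j = r &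
      forall (r : 'I_m) (c : 'I_n), c < j -> (M r c != 0)%R -> iarr s' 1 c = r]));
  rewrite ?muln1 //; last first.
  move=> s' [ag' i3 _ new old]; split=> //; split=> //.
    exact: agree_ivar.
  move=> r c; rewrite ltnS leq_eqVlt -[(c : nat) == j]/(c == j).
  by case: eqP => [->|_] //= *; [apply: new | apply: old].
rewrite -[X in runs _ X]muln1.
apply: (runs_for (I := fun i s' =>
  [/\ agree [:: 3; 4] [::] [:: 1] s s', ivar s' 3 = j, ivar s' 4 = i,
      forall r : 'I_m, r < i -> (M r j != 0)%R -> iarr s' 1 j = r &
      forall (r : 'I_m) (c : 'I_n), c < j -> (M r c != 0)%R -> iarr s' 1 c = r])) => //.
- by move=> i s' [[v _ _] _ -> _ _]; split=> //; rewrite v.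
- by split=> //; apply: agree_ivar.
move=> i t' [ag' i3 i4 new old]; apply: runs_if => //=; rewrite i3 i4 !entryE.
  move=> Mij; apply: runs_iput => //=; rewrite i3 i4; split=> //; split=> //.
  - by apply: agree_ivar => //; apply: agree_iarr.
  - by move=> r _ Mrj; rewrite /= /upd !eqxx (matchM.2 _ _ _ Mij Mrj).
  move=> r c ltcj Mrc; rewrite /= /upd /= ltn_eqF //; exact: old.
rewrite negbK => /eqP Mij; apply: runs_skip => //; split=> //; split=> //.
  exact: agree_ivar.
move=> r; rewrite ltnS leq_eqVlt -[(r : nat) == i]/(r == i).
by case: eqP => [->|_] /=; [rewrite Mij eqxx | apply: new].
Qed.

Lemma runs_RhoRanks s :
  ivar s 0 = m -> (forall r : 'I_m, farr s 5 r = null_rows M r r) ->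
  runs inp (m * n) RhoRanks s (fun s' => [/\ agree [:: 3; 5] [::] [:: 2] s s',
    forall i, iarr s' 2 (rho (M := M) i) = i &
    forall r : 'I_m, r \notin nzrows M -> #|nzrows M| <= iarr s' 2 r]).
Proof.
move=> s0 s5; apply: (runs_seq (Q1 := eq^~ (set_ivar s 5 0))).
- by rewrite muln_gt0 m_gt0.
- by apply: runs_iset; rewrite // muln_gt0 m_gt0.
move=> _ ->; apply: (runs_conseq (T := m * 1) (Q := fun s' =>
  [/\ agree [:: 3; 5] [::] [:: 2] s s', ivar s' 3 = m, ivar s' 5 = rho_rank M m &
   forall r : 'I_m, r < m -> iarr s' 2 r = if r \in nzrows M then rho_rank M r else m])).
- apply: (runs_for (I := fun j s' => [/\ agree [:: 3; 5] [::] [:: 2] s s',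
    ivar s' 3 = j, ivar s' 5 = rho_rank M j &
    forall r : 'I_m, r < j -> iarr s' 2 r = if r \in nzrows M then rho_rank M r else m])) => //.
  + by move=> j s' [[v _ _] -> _ _]; split=> //; rewrite v.
  + split=> //; first by do 2 apply: agree_ivar => //.
    by rewrite /rho_rank take0.
  move=> j t [ag i3 i5 iE]; case: (ag) => v f _.
  have upd_ok x (y : nat) (r : 'I_m) : r < j.+1 ->
    x = (if j \in nzrows M then rho_rank M j else m) ->
    upd (iarr t 2) j x r = if r \in nzrows M then rho_rank M r else m.
    rewrite ltnS leq_eqVlt -[(r : nat) == j]/(r == j) /upd -[(r : nat) == j]/(r == j).
    by case: eqP => [-> _ ->|_ /= ltr _] //; apply: iE.
  apply: runs_if => //=; rewrite i3 f // s5 (null_rowsE properRMDC) eqxx /=.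
    have [Mj _|Mj /=] := boolP (j \in nzrows M); last by rewrite oner_eq0.
    apply: (runs_seq (Q1 := eq^~ (put_iarr t 2 j (rho_rank M j)))) => //.
      by apply: runs_iput => //=; rewrite i3 i5.
    move=> _ ->; apply: runs_iset => //=; split=> //; split=> //=.
    - by do 2 apply: agree_ivar => //; apply: agree_iarr.
    - by rewrite /upd /= i5 (rho_rankS M j) Mj addn1.
    by move=> r ltr; apply: upd_ok => //; rewrite Mj.
  have [Mj|Mj _] := boolP (j \in nzrows M); first by rewrite eqxx.
  apply: runs_iput => //=; rewrite i3 v // s0; split=> //; split=> //=.
  - by apply: agree_ivar => //; apply: agree_iarr.
  - by rewrite /upd /= i5 (rho_rankS M j) (negPf Mj) addn0.
  by move=> r ltr; apply: upd_ok => //; rewrite (negPf Mj).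
- by rewrite leq_mul2l n_gt0 orbT.
move=> s' [ag _ _ iE]; split=> // [i|r Mr].
  by rewrite iE // /rho enum_valP; apply: rho_rankK.
by rewrite iE // (negPf Mr) card_nzrows_le.
Qed.

Lemma runs_Reversal s :
  ivar s 1 = n ->
  runs inp (m * n) Reversal s (fun s' => agree [:: 3; 5] [::] [:: 3] s s' /\
    forall j : 'I_n, iarr s' 3 j = rev_ord j).
Proof.
move=> s1; apply: (runs_seq (Q1 := eq^~ (set_ivar s 5 n))).
- by rewrite muln_gt0 m_gt0.
- by apply: runs_iset; rewrite /= ?s1 // muln_gt0 m_gt0.
move=> _ ->; apply: (runs_conseq (T := n * 1) (Q := fun s' =>
  [/\ agree [:: 3; 5] [::] [:: 3] s s', ivar s' 3 = n, ivar s' 5 = n - n &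
   forall j : 'I_n, j < n -> iarr s' 3 j = rev_ord j])).
- apply: (runs_for (I := fun i s' => [/\ agree [:: 3; 5] [::] [:: 3] s s',
    ivar s' 3 = i, ivar s' 5 = n - i &
    forall j : 'I_n, j < i -> iarr s' 3 j = rev_ord j])) => //.
  + by move=> j s' [[v _ _] -> _ _]; split=> //; rewrite v.
  + by split; rewrite /= ?subn0 //; do 2 apply: agree_ivar => //.
  move=> j t [ag i3 i5 iE].
  apply: (runs_seq (Q1 := eq^~ (set_ivar t 5 (n - j.+1)))) => //.
    by apply: runs_iset; rewrite //= i5 subnS.
  move=> _ ->; apply: runs_iput => //=; rewrite /upd /= i3; split=> //; split=> //=.
    by apply: agree_ivar => //; apply: agree_iarr => //; apply: agree_ivar.
  move=> i; rewrite ltnS leq_eqVlt /upd /=.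
  by case: eqP => [->|_ /=] //; apply: iE.
- by rewrite muln1 leq_pmull.
by move=> s' [ag _ _ iE]; split=> // j; apply: iE.
Qed.

(** Array 2 is recorded apart from [prepared] because it is the vector [z], zero before [Solve] and
    changed by it. *)
Lemma runs_Prelude k :
  runs inp (m * n) Prelude (init_store K m n k)
    (fun s => prepared k s /\ forall r : 'I_m, farr s 2 r = 0%R).
Proof.
have mn0 : 0 < m * n by rewrite muln_gt0 m_gt0.
set s0 := init_store K m n k.
apply: (runs_seq (Q1 := eq^~ (put_farr s0 4 k 1%R))) => //; first exact: runs_fput.
move=> _ ->; set s1 := put_farr _ _ _ _.
apply: runs_seq => //.
  apply: (runs_tabulate (E := fun r c => (M r c * (M r c)^-1)%R)
    (f := fun r => null_rows M r r)) => //.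
    by move=> a i s' _ i3 i4; rewrite /= i3 i4 !entryE.
  move=> a s' _ _ acc; rewrite /= acc /null_rows [RHS]mxE [X in _ = (_ + X)%R]mxE
    [X in _ = (X + _)%R]mxE eqxx; congr (_ - _)%R.
  by rewrite [in RHS]mxE; apply: eq_bigr => c _; rewrite mxE.
move=> s2 [ag2 E2]; apply: runs_seq => //.
  rewrite mulnC; case: ag2 => v2 _ _.
  apply: (runs_tabulate (E := fun c r => ((M r c)^-1 * M r c)%R)
    (f := fun c => null_cols M c c)); rewrite ?v2 //.
    by move=> a i s' _ i3 i4; rewrite /= i3 i4 !entryE.
  move=> a s' _ _ acc; rewrite /= acc /null_cols [RHS]mxE [X in _ = (_ + X)%R]mxE
    [X in _ = (X + _)%R]mxE eqxx; congr (_ - _)%R.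
  by rewrite [in RHS]mxE; apply: eq_bigr => c _; rewrite mxE.
move=> s3 [ag3 E3]; apply: runs_seq => //.
  rewrite mulnC; case: ag2 => v2 _ _; case: ag3 => v3 _ _.
  apply: (runs_tabulate (E := fun c r => ((M r c)^-1)%R)
    (f := fun c => (\sum_r (M r c)^-1)%R)); rewrite ?v3 ?v2 //.
  by move=> a i s' _ i3 i4; rewrite /= i3 i4 entryE.
move=> s4 [ag4 E4].
case: ag2 => v2 f2 j2; case: ag3 => v3 f3 j3; case: ag4 => v4 f4 j4.
apply: runs_seq => //; first by rewrite mulnC; apply: runs_MatchedRows; rewrite v4 ?v3 ?v2.
move=> s5 [[v5 f5 j5] E5]; apply: runs_seq => //.
  apply: runs_RhoRanks; first by rewrite v5 ?v4 ?v3 ?v2.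
  by move=> r; rewrite f5 ?f4 ?f3.
move=> s6 [[v6 f6 j6] E6 E6'].
apply: runs_conseq (runs_Reversal _) _ _ => //; first by rewrite v6 ?v5 ?v4 ?v3 ?v2.
move=> s7 [[v7 f7 j7] E7]; split; last first.
  by move=> r; rewrite f7 ?f6 ?f5 ?f4 ?f3 ?f2.
split=> //.
- by rewrite v7 ?v6 ?v5 ?v4 ?v3 ?v2.
- by rewrite v7 ?v6 ?v5 ?v4 ?v3 ?v2.
- by rewrite v7 ?v6 ?v5 ?v4 ?v3 ?v2.
- by move=> j; rewrite f7 ?f6 ?f5 ?f4 ?f3 ?f2 //= /upd /=; case: eqP.
- by move=> r; rewrite f7 ?f6 ?f5 ?f4 ?f3.
- by move=> r; rewrite f7 ?f6 ?f5 ?f4.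
- by move=> r; rewrite f7 ?f6 ?f5.
- by move=> r c Mrc; rewrite j7 ?j6 // (E5 r).
- by move=> i; rewrite j7.
by move=> r Mr; rewrite j7 // E6'.
Qed.

(** * Solving with [C^-1] and assembling the output *)

Lemma eval_MpS k s c r (c' : 'I_n) (r' : 'I_m) :
  prepared k s -> ieval s c = c' -> ieval s r = r' ->
  feval inp s (MpS_ c r) = (matching_pinv M *m rho_inv M R)%R c' r'.
Proof.
move=> prep ec er; rewrite /= ec er; apply/esym.
apply: (pinv_rho_inv_entry properRMDC (mu := farr s 7) (rowof := iarr s 1)).
- exact: (prep_rank prep).
- exact: (prep_out prep).
- by move=> i; apply: (prep_matched prep).
- exact: (prep_pivot_inv prep).
Qed.

Lemma eval_Sinv k s r1 r2 (r1' r2' : 'I_m) :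
  prepared k s -> ieval s r1 = r1' -> ieval s r2 = r2' ->
  feval inp s (Sinv_ r1 r2) = rho_inv M R r1' r2'.
Proof.
move=> prep e1 e2; rewrite /= e1 e2; apply/esym/rho_inv_entry.
- exact: (prep_rank prep).
- exact: (prep_out prep).
Qed.

Lemma eval_D s r c (r' : 'I_m) (c' : 'I_n) :
  ieval s r = r' -> ieval s c = c' -> feval inp s (D_ r c) = D r' c'.
Proof. by move=> er ec; rewrite /= er ec entryE. Qed.

(** The solution of [x C^-1 = b], respectively of [C^-1 x = b]. *)
Definition solution (l : line) (b : 'I_n -> K) (c : 'I_n) : K :=
  match l with
  | Row => \sum_i b i * C i c
  | Col => \sum_i C c i * b i
  end%R.

(** Off the diagonal [I''] vanishes and [C^-1] equals [M^+ S D], which factors through dimension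
    [m]; the diagonal of [C^-1] is 1. *)
Lemma runs_SolveC k l s (b : 'I_n -> K) :
  prepared k s -> (forall r : 'I_m, farr s 2 r = 0%R) ->
  (forall c : 'I_n, farr s 1 c = b c) ->
  runs inp (m * n) (SolveC l) s (fun s' => prepared k s' /\
    forall c : 'I_n, farr s' 3 c = solution l b c).
Proof.
move=> prep z0 b0.
have unitriC : upper_unitri C by case: properRMDC => [[]].
have [CV0 CV1] := upper_unitri_invmx unitriC.
have Cunit := upper_unitri_unitmx unitriC.
have sub s' : agree [:: 3; 4; 5] [:: 2; 3] [::] s s' -> prepared k s'.
  move=> ag; apply: prepared_agree prep _; apply: agree_sub ag _ _ _ => // x.
  by rewrite !inE => /orP[]->; rewrite ?orbT.
have CVE c c' : c != c' ->
    invmx C c c' = (matching_pinv M *m rho_inv M R *m D)%R c c'.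
  move=> necc'; rewrite (invmx_C_E properRMDC) [LHS]mxE (null_colsE properRMDC).
  by rewrite (negPf necc') add0r.
rewrite mulnC; case: l.
  apply: (runs_conseq (runs_solve (o := id) (b := b) (X := solution Row b)
    (P := fun c r => D^T%R c r)
    (Q := fun c r => (matching_pinv M *m rho_inv M R)%R c r) _ _ _ _ _ _ _ _ _ _)) => //.
  - exact: (prep_m prep).
  - exact: (prep_n prep).
  - move=> c r s' ag i5 i4; rewrite (@eval_D s' (IVar 4) (IVar 5) r c) //
    (@eval_MpS k s' (IVar 5) (IVar 4) c r) //; last exact: sub.
    by rewrite [(D^T)%R _ _]mxE.
  - apply: (unitriangular_substitution (A := ((invmx C)^T)%R)).
    + by exists id.
    + by move=> c; rewrite mxE.
    + by move=> i j ltji; rewrite mxE CV0.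
    + move=> c c' necc'; rewrite mxE CVE 1?eq_sym // mxE.
      by apply: eq_bigr => r _; rewrite [(D^T)%R _ _]mxE mulrC.
    move=> c; pose bv := (\row_j b j)%R.
    transitivity ((bv *m C *m invmx C)%R 0%R c); last by rewrite mulmxK // mxE.
    rewrite [RHS]mxE; apply: eq_bigr => i _; rewrite mxE mulrC; congr (_ * _)%R.
    by rewrite [RHS]mxE; apply: eq_bigr => j _; rewrite mxE.
  by move=> s' [/sub prep' xE]; split.
apply: (runs_conseq (runs_solve (o := @rev_ord n) (b := b) (X := solution Col b)
  (P := fun c r => (matching_pinv M *m rho_inv M R)%R c r)
  (Q := fun c r => D^T%R c r) _ _ _ _ _ _ _ _ _ _)) => //.
- exact: (prep_m prep).
- exact: (prep_n prep).
- exact: rev_ord_inj.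
- by move=> j s' /sub prep' i3; rewrite /= i3 (prep_rev prep').
- move=> c r s' ag i5 i4; rewrite (@eval_D s' (IVar 4) (IVar 5) r c) //
    (@eval_MpS k s' (IVar 5) (IVar 4) c r) //; last exact: sub.
  by rewrite [(D^T)%R _ _]mxE.
(* Reversing the order of the unknowns makes [C^-1] lower unitriangular. *)
- apply: (unitriangular_substitution (A := invmx C)).
  + by exists (@rev_ord n); apply: rev_ordK.
  + exact: CV1.
  + by move=> i j ltji; rewrite CV0 //=; have := ltn_ord i; lia.
  + move=> c c' necc'; rewrite CVE // mxE.
    by apply: eq_bigr => r _; rewrite [(D^T)%R _ _]mxE.
  move=> c; pose bv := (\col_j b j)%R.
  transitivity ((invmx C *m (C *m bv))%R c 0%R); last by rewrite mulKmx // mxE.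
  rewrite [RHS]mxE; apply: eq_bigr => i _; congr (_ * _)%R.
  by rewrite [RHS]mxE; apply: eq_bigr => j _; rewrite mxE.
move=> s' [/sub prep' xE]; split=> // c.
by rewrite -(rev_ordK c) xE.
Qed.

Lemma runs_rhs k t l s (b : 'I_n -> K) :
  prepared k s -> (forall r : 'I_m, farr s 2 r = 0%R) ->
  (forall (c : 'I_n) s', prepared k s' -> ivar s' 3 = c ->
     feval inp s' (rhs t l) = b c) ->
  runs inp (m * n) (Tabulate 1 1 0 FZero (rhs t l)) s
    (fun s' => [/\ prepared k s', forall r : 'I_m, farr s' 2 r = 0%R &
               forall c : 'I_n, farr s' 1 c = b c]).
Proof.
move=> prep z0 evb.
have sub s' : agree [:: 3; 4] [:: 1] [::] s s' -> prepared k s'.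
  move=> ag; apply: prepared_agree prep _; apply: agree_sub ag _ _ _ => // x.
    by rewrite !inE => /orP[]->; rewrite ?orbT.
  by rewrite !inE => ->; rewrite orbT.
rewrite mulnC.
apply: (runs_conseq (runs_tabulate (E := fun (_ : 'I_n) (_ : 'I_m) => 0%R) (f := b)
  _ _ _ _ _ _ _ _)) => //.
- exact: (prep_n prep).
- exact: (prep_m prep).
- by move=> c s' /sub prep' i3 _; apply: evb.
move=> s' [ag bE]; split=> //; first exact: sub.
by case: ag => _ f _ r; rewrite f.
Qed.

(** Reduces each of the eight requests to evaluating three expressions in an arbitrary prepared
    store. *)
Lemma runs_reconstruct t l (k : nat) (b : 'I_n -> K)
    (E : 'I_(target_dim t m n) -> 'I_(target_dim (transposed t) m n) -> K)
    (v : 'I_(target_dim t m n) -> K) :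
  (forall (c : 'I_n) s, prepared k s -> ivar s 3 = c ->
     feval inp s (rhs t l) = b c) ->
  (forall (a : 'I_(target_dim t m n)) (i : 'I_(target_dim (transposed t) m n)) s,
     prepared k s ->
     (forall c : 'I_n, farr s 3 c = solution l b c) ->
     ivar s 3 = a -> ivar s 4 = i -> feval inp s (out_term t l) = E a i) ->
  (forall (a : 'I_(target_dim t m n)) s, prepared k s ->
     (forall c : 'I_n, farr s 3 c = solution l b c) ->
     ivar s 3 = a -> fvar s 0 = (\sum_i E a i)%R ->
     feval inp s (out_expr t l) = v a) ->
  runs inp (m * n) (reconstruct t l) (init_store K m n k)
    (fun s => forall j : 'I_(target_dim t m n), farr s 0 j = v j).
Proof.
move=> evb evE evv; have mn0 : 0 < m * n by rewrite muln_gt0 m_gt0.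
apply: (runs_seq _ (runs_Prelude k)) => // s1 [prep1 z1].
apply: (runs_seq _ (runs_rhs prep1 z1 evb)) => // s2 [prep2 z2 b2].
apply: (runs_seq _ (runs_SolveC l prep2 z2 b2)) => // s3 [prep3 x3].
have -> : m * n = target_dim t m n * target_dim (transposed t) m n.
  by case: t {evb E v evE evv} => //=; rewrite mulnC.
have dim_regE t' : ivar s3 (dim_reg t') = target_dim t' m n.
  by case: t' => /=; rewrite ?(prep_m prep3) ?(prep_n prep3).
have sub s : agree [:: 3; 4] [:: 0] [::] s3 s ->
    prepared k s /\ forall c : 'I_n, farr s 3 c = solution l b c.
  move=> ag; split; last by case: ag => _ f _ c; rewrite f.
  apply: prepared_agree prep3 _; apply: agree_sub ag _ _ _ => // y.
    by rewrite !inE => /orP[]->; rewrite ?orbT.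
  by rewrite !inE => ->.
apply: (runs_conseq (runs_tabulate (E := E) (f := v) _ _ _ _ _ _ _ _)) => //.
- by case: (t).
- by case: (t).
- by case: (t).
- by case: (t).
- by move=> a i s /sub[]; apply: evE.
- by move=> a s /sub[]; apply: evv.
by move=> s [].
Qed.

End Correctness.

(* The requested row or column is left in cells 0, 1, ... of field array 0. *)
Theorem mainTheorem3 (t : target) (l : line) :
  exists (p : cmd) (c : nat),
  forall (K : fieldType) (m n : nat) (D M : 'M[K]_(m, n))
         (R : 'M[K]_m) (C : 'M[K]_n) (k : 'I_(target_dim t m n)),
    0 < m -> 0 < n ->
    proper_umatch R M D C ->
    exists (time : nat) (s : store K),
      [/\ exec (umatch_inputs D M R) p (init_store K m n k) time s,
          time <= c * (m * n) &
          forall j : 'I_(target_dim t m n),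
            farr s 0 j = line_entry l (target_mx t R C) k j].
Proof.
(* The constant is the syntactic [csize], so [runs] with [T = m * n] is the claim verbatim. *)
exists (reconstruct t l), (csize (reconstruct t l)) => K m n D M R C k m0 n0 properRMDC.
change (runs (umatch_inputs D M R) (m * n) (reconstruct t l) (init_store K m n k)
  (fun s => forall j : 'I_(target_dim t m n),
     farr s 0 j = line_entry l (target_mx t R C) k j)).
have sumE p q r (A : 'M[K]_(p, q)) (B : 'M[K]_(q, r)) i j :
    (\sum_h A i h * B h j = (A *m B) i j)%R by rewrite mxE.
pose N := (matching_pinv M *m rho_inv M R)%R.
have NE := eval_MpS properRMDC.
have fevalM s e1 e2 : feval (umatch_inputs D M R) s (FMul e1 e2)
    = (feval (umatch_inputs D M R) s e1 * feval (umatch_inputs D M R) s e2)%R by [].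
have fevalD s e1 e2 : feval (umatch_inputs D M R) s (FAdd e1 e2)
    = (feval (umatch_inputs D M R) s e1 + feval (umatch_inputs D M R) s e2)%R by [].
have SE := @eval_Sinv K m n D M R.
case: t k; case: l => k /=.
(* Row [k] of [R] is row [k] of [I'] plus [(D_k C) M^+], with [D_k] row [k] of [D]. *)
- apply: (runs_reconstruct properRMDC m0 n0 (t := TR) (l := Row) (b := D k)
    (E := fun j c => ((D *m C) k c * matching_pinv M c j)%R)).
  + by move=> c s prep i3; apply: eval_D; rewrite //= (prep_k prep).
  + move=> j c s prep xE i3 i4; rewrite /= i3 i4 xE /= sumE entryE.
    by rewrite [matching_pinv M _ _]mxE.
  move=> j s prep xE i3 acc; rewrite /= acc i3 (prep_null_row prep) (prep_unit prep).
  rewrite sumE (null_rows_delta properRMDC) (null_rows_sym properRMDC).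
  by rewrite [in RHS](R_E properRMDC) [in RHS]mxE.
- apply: (runs_reconstruct properRMDC m0 n0 (t := TR) (l := Col)
    (b := fun c => matching_pinv M c k)
    (E := fun j c => (D j c * (C *m matching_pinv M) c k)%R)).
  + by move=> c s prep i3; rewrite /= i3 (prep_k prep) entryE mxE.
  + by move=> j c s prep xE i3 i4; rewrite /= i3 i4 xE /= sumE entryE.
  move=> j s prep xE i3 acc; rewrite /= acc i3 (prep_null_row prep) (prep_unit prep).
  rewrite sumE mulmxA (null_rows_delta properRMDC).
  by rewrite [in RHS](R_E properRMDC) [in RHS]mxE.
(* Row [k] of [R^-1] is [I'_kk (e_k - (D_k C) N) + S_k], with [N = M^+ S]. *)
- apply: (runs_reconstruct properRMDC m0 n0 (t := TRinv) (l := Row) (b := D k)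
    (E := fun j c => ((D *m C) k c * N c j)%R)).
  + by move=> c s prep i3; apply: eval_D; rewrite //= (prep_k prep).
  + move=> j c s prep xE i3 i4.
    by rewrite /out_term fevalM (NE _ _ _ _ c j prep) //= i4 xE /= sumE.
  move=> j s prep xE i3 acc.
  rewrite /out_expr fevalD (SE _ _ _ _ k j prep) //=; last exact: (prep_k prep).
  rewrite (prep_k prep) acc i3 (prep_null_row prep) (prep_unit prep) sumE (invmx_R_E properRMDC).
  rewrite [in RHS]mxE (null_rows_mulmx properRMDC); congr (_ * _ + _)%R.
  by rewrite [in RHS]mxE [X in (_ = X + _)%R]mxE [X in (_ = _ + X)%R]mxE eq_sym mulmxA.
(* Column [k] of [R^-1] is [I' (e_k - D (C N_k)) + S_k], where [N_k] and [S_k] are columns. *)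
- apply: (runs_reconstruct properRMDC m0 n0 (t := TRinv) (l := Col)
    (b := fun c => N c k) (E := fun j c => (D j c * (C *m N) c k)%R)).
  + by move=> c s prep i3; apply: (NE _ _ _ _ _ _ prep); rewrite //= (prep_k prep).
  + by move=> j c s prep xE i3 i4; rewrite /= i3 i4 xE /= sumE entryE.
  move=> j s prep xE i3 acc.
  rewrite /out_expr fevalD (SE _ _ _ _ j k prep) //=; last exact: (prep_k prep).
  rewrite acc i3 (prep_null_row prep) (prep_unit prep) sumE (invmx_R_E properRMDC).
  rewrite [in RHS]mxE (null_rows_mulmx properRMDC); congr (_ * _ + _)%R.
  by rewrite [in RHS]mxE [X in (_ = X + _)%R]mxE [X in (_ = _ + X)%R]mxE !mulmxA.
- apply: (runs_reconstruct properRMDC m0 n0 (t := TC) (l := Row)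
    (b := fun c => (1%:M : 'M_n)%R k c) (E := fun _ _ => 0%R)) => //.
    by move=> c s prep i3; rewrite /= (prep_unit prep) i3 mxE eq_sym.
  by move=> j s prep xE i3 _; rewrite /= i3 xE /= sumE mul1mx.
- apply: (runs_reconstruct properRMDC m0 n0 (t := TC) (l := Col)
    (b := fun c => (1%:M : 'M_n)%R c k) (E := fun _ _ => 0%R)) => //.
    by move=> c s prep i3; rewrite /= (prep_unit prep) i3 mxE.
  by move=> j s prep xE i3 _; rewrite /= i3 xE /= sumE mulmx1.
(* Row [k] of [C^-1] is row [k] of [I''] plus [N_k D], with [N_k] read off entry by entry. *)
- apply: (runs_reconstruct properRMDC m0 n0 (t := TCinv) (l := Row)
    (b := fun c => (1%:M : 'M_n)%R k c) (E := fun j r => (N k r * D r j)%R)).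
  + by move=> c s prep i3; rewrite /= (prep_unit prep) i3 mxE eq_sym.
  + move=> j r s prep xE i3 i4.
    by rewrite /out_term fevalM (NE _ _ _ _ k r prep) /= ?(prep_k prep) // i3 i4 entryE.
  move=> j s prep xE i3 acc; rewrite /= acc i3 (prep_null_col prep) (prep_unit prep).
  rewrite sumE (null_cols_delta properRMDC) (null_cols_sym properRMDC).
  by rewrite (invmx_C_E properRMDC) [in RHS]mxE.
apply: (runs_reconstruct properRMDC m0 n0 (t := TCinv) (l := Col)
  (b := fun c => (1%:M : 'M_n)%R k c) (E := fun j r => (N j r * D r k)%R)).
- by move=> c s prep i3; rewrite /= (prep_unit prep) i3 mxE eq_sym.
- move=> j r s prep xE i3 i4.
  by rewrite /out_term fevalM (NE _ _ _ _ j r prep) //= (prep_k prep) i4 entryE.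
move=> j s prep xE i3 acc; rewrite /= acc i3 (prep_null_col prep) (prep_unit prep).
rewrite sumE (null_cols_delta properRMDC).
by rewrite (invmx_C_E properRMDC) [in RHS]mxE.
Qed.
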